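(* (i) If $f:[a,b]\to\mathbb{R}_{\mathcal F}$ is strongly measurable, then $F:[a,b]\to[0,\infty)$, $F(x)=D(\tilde0,f(x))$, is Lebesgue measurable on $[a,b]$. (ii) Let $1\le p<\infty$. For any $f,g\in L^p([a,b];\mathbb{R}_{\mathcal F})$, the function $F(x)=D(f(x),g(x))$ is Lebesgue measurable and $\int_a^bF(x)^pdx<\infty$. Moreover, with $$D_p(f,g)=\Big(\int_a^b[D(f(x),g(x))]^pdx\Big)^{1/p},$$ $(L^p([a,b];\mathbb{R}_{\mathcal F}),D_p)$ is a complete metric space (where $f=g$ means $f(x)=g(x)$ for a.e. $x\in[a,b]$), and for all $f,g,h,e\in L^p([a,b];\mathbb{R}_{\mathcal F})$, $\lambda\in\mathbb{R}$: $D_p(f\oplus h,g\oplus h)=D_p(f,g)$, $D_p(\lambda\odot f,\lambda\odot g)=|\lambda|D_p(f,g)$, $D_p(f\oplus g,h\oplus e)\le D_p(f,h)+D_p(g,e)$.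
   Context: A fuzzy number is a function $u:\mathbb{R}\to[0,1]$ which is normal, fuzzy convex ($u(tx+(1-t)y)\ge\min\{u(x),u(y)\}$), upper semicontinuous, and with $\overline{\{x:u(x)>0\}}$ compact; $\mathbb{R}_{\mathcal F}$ is the set of fuzzy numbers. Level sets $[u]^r=\{x:u(x)\ge r\}$ ($r\in(0,1]$), $[u]^0=\overline{\{u>0\}}$, are compact intervals $[u_-(r),u_+(r)]$. Operations: $[u\oplus v]^r=[u]^r+[v]^r$, $[\lambda\odot u]^r=\lambda[u]^r$, $\tilde0=\chi_{\{0\}}$; metric $D(u,v)=\sup_{r\in[0,1]}\max\{|u_-(r)-v_-(r)|,|u_+(r)-v_+(r)|\}$. Operations on functions are pointwise. Writing $[f(x)]^r=[f_-(x)(r),f_+(x)(r)]$, $f:[a,b]\to\mathbb{R}_{\mathcal F}$ is strongly measurable if for each $r\in[0,1]$ the functions $x\mapsto f_-(x)(r)$ and $x\mapsto f_+(x)(r)$ are Lebesgue measurable on $[a,b]$. $L^p([a,b];\mathbb{R}_{\mathcal F})$ is the set of strongly measurable $f$ with $\int_a^b(D(\tilde0,f(x)))^pdx<\infty$. *)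

(* Defs.v *)
From HB Require Import structures.
From mathcomp Require Import all_boot all_order all_algebra.
From mathcomp Require Import all_classical all_reals all_analysis.
Set Implicit Arguments.
Unset Strict Implicit.
Unset Printing Implicit Defensive.
Import Order.TTheory GRing.Theory Num.Theory.
Import numFieldNormedType.Exports.

Local Open Scope classical_set_scope.
Local Open Scope ring_scope.

(* The measurable type of the (completed) Lebesgue sigma-algebra on R:
   the carrier is R, the measurable sets are the Lebesgue measurable sets. *)
Definition LebT (R : realType) : Type :=
  ltac:(let t := type of (@completed_lebesgue_measure R) in
        match t with set ?T -> _ => exact T end).

Definition leb_measurable_fun (R : realType) (D : set R) (f : R -> R) : Prop :=
  @measurable_fun _ _ (LebT R) R (D : set (LebT R)) (f : LebT R -> R).

Section Fuzzy.
Variable R : realType.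
Implicit Types (u v : R -> R).

Definition is_fuzzy u : Prop :=
  [/\ (forall x, 0 <= u x <= 1),
      (exists x, u x = 1),
      (forall x y t, 0 <= t <= 1 ->
         Num.min (u x) (u y) <= u (t * x + (1 - t) * y)),
      (forall x e, 0 < e -> \forall y \near x, u y < u x + e) &
      compact (closure [set x | 0 < u x])].

Definition level u (r : R) : set R :=
  if r == 0 then closure [set x | 0 < u x] else [set x | r <= u x].

Definition lend u (r : R) : R := inf (level u r).
Definition rend u (r : R) : R := sup (level u r).

Definition fD u v : R :=
  sup [set Num.max `|lend u r - lend v r| `|rend u r - rend v r|
      | r in `[0, 1]].

Definition fzero : R -> R := fun x => if x == 0 then 1 else 0.

(** the fuzzy set whose r-level sets (0 < r <= 1) are A r *)
Definition from_levels (A : R -> set R) : R -> R :=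
  fun x => sup ([set r | 0 < r <= 1 /\ A r x] `|` [set 0]).

Definition fadd u v : R -> R :=
  from_levels (fun r => [set z | exists x y, [/\ level u r x, level v r y & z = x + y]]).
Definition fscale (l : R) u : R -> R :=
  from_levels (fun r => [set z | exists x, level u r x /\ z = l * x]).

Definition Fadd (f g : R -> R -> R) : R -> R -> R := fun x => fadd (f x) (g x).
Definition Fscale (l : R) (f : R -> R -> R) : R -> R -> R := fun x => fscale l (f x).

Definition strongly_measurable (a b : R) (f : R -> R -> R) : Prop :=
  forall r, 0 <= r <= 1 ->
    leb_measurable_fun `[a, b] (fun x => lend (f x) r) /\
    leb_measurable_fun `[a, b] (fun x => rend (f x) r).

Definition fuzzy_valued (a b : R) (f : R -> R -> R) : Prop :=
  forall x, a <= x <= b -> is_fuzzy (f x).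

Definition intF_ab (a b : R) (F : R -> R) : \bar R :=
  (\int[@completed_lebesgue_measure R]_(x in (`[a, b] : set (LebT R)))
     (F x)%:E)%E.

Definition LpF (p a b : R) (f : R -> R -> R) : Prop :=
  [/\ fuzzy_valued a b f, strongly_measurable a b f &
      (intF_ab a b (fun x => powR (fD fzero (f x)) p) < +oo)%E].

Definition DpF (p a b : R) (f g : R -> R -> R) : R :=
  powR (fine (intF_ab a b (fun x => powR (fD (f x) (g x)) p))) p^-1.

Definition fae_eq (a b : R) (f g : R -> R -> R) : Prop :=
  {ae @completed_lebesgue_measure R,
     forall x : LebT R, `[a, b]%classic x -> f x = g x}.

End Fuzzy.
Arguments fzero {R}.

(* Main.v *)
Require Import Defs.
From HB Require Import structures.
From mathcomp Require Import all_boot all_order all_algebra.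
From mathcomp Require Import all_classical all_reals all_analysis.
From mathcomp Require Import measurable_realfun ring lra.
Import Order.TTheory GRing.Theory Num.Theory.
Import numFieldNormedType.Exports.
Local Open Scope classical_set_scope.
Local Open Scope ring_scope.

(** A fuzzy number is determined by its endpoint functions [lend u], [rend u],
and (Goetschel-Voxman) a pair of functions on [0, 1] arises in this way iff the
first is nondecreasing, the second nonincreasing, both are left-continuous on
(0, 1] and right-continuous at 0, and they are ordered at 1.  These conditions
pass to sums, scalar multiples and uniform limits, which gives the endpoints of
[fadd] and [fscale] and the completeness of [fD].  By left-continuity the
supremum defining [fD] may be restricted to rational levels, whence the
measurability statements.  Since [fD] satisfies the triangle inequality, the
metric axioms and the inequalities for D_p reduce to Minkowski's inequality for
real functions.  For completeness, a subsequence with fast decaying D_p-increments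
converges a.e. in [fD], and Fatou's lemma turns this into convergence in D_p. *)

Set Implicit Arguments.
Unset Strict Implicit.
Unset Printing Implicit Defensive.

(** * Functions that can be endpoints of level sets, and their closure properties *)

Section Endpoints.
Variable R : realType.
Implicit Types (L U : R -> R) (u v w : R -> R) (r s z : R).

(* The last two conditions are left-continuity on (0, 1] and right-continuity at 0,
   in the order-theoretic form they take for a nondecreasing function. *)
Definition lower_end L : Prop :=
  [/\ forall r s, 0 <= r -> r <= s -> s <= 1 -> L r <= L s,
      forall r z, 0 < r <= 1 -> (forall s, 0 < s < r -> L s <= z) -> L r <= z &
      forall z, (forall s, 0 < s <= 1 -> z <= L s) -> z <= L 0].

Definition endpoints L U : Prop :=
  [/\ lower_end L, lower_end (\- U) & L 1 <= U 1].

(** The limit conditions are applied to one summand at a time, which leaves two independent levels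
    [s] and [t]. By monotonicity both can be replaced by their maximum (left-continuity) or their
    minimum (right-continuity at 0), where the hypothesis on the sum applies. *)
Lemma lower_endD L L' : lower_end L -> lower_end L' -> lower_end (L \+ L').
Proof.
move=> [mL lL rL] [mL' lL' rL']; split => [r s r0 rs s1|r z r01 H|z H] /=.
- by apply: lerD; [exact: mL|exact: mL'].
- rewrite addrC -lerBrDr; apply: lL' => // s /andP[s0 sr].
  rewrite lerBrDr addrC -lerBrDr; apply: lL => // t /andP[t0 tr].
  have r1 : r <= 1 by case/andP: r01.
  have m0 : 0 < Num.max s t by rewrite lt_max s0.
  have mr : Num.max s t < r by rewrite gt_max sr.
  rewrite lerBrDr (le_trans _ (H (Num.max s t) _)) ?m0//.
  by apply: lerD; [apply: mL|apply: mL'];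
    rewrite ?le_max ?lexx ?orbT// ltW// (lt_le_trans mr).
- rewrite -lerBlDr; apply: rL => // s /andP[s0 s1].
  rewrite lerBlDr addrC -lerBlDr; apply: rL' => // t /andP[t0 t1].
  have m0 : 0 < Num.min s t by rewrite lt_min s0.
  have m1 : Num.min s t <= 1 by rewrite ge_min s1.
  rewrite lerBlDr (le_trans (H (Num.min s t) _)) ?m0//= addrC.
  by apply: lerD; [apply: mL'|apply: mL]; rewrite ?ge_min ?lexx ?orbT// ltW.
Qed.

Lemma lower_endZ l L : 0 <= l -> lower_end L -> lower_end (fun r => l * L r).
Proof.
(* For [l = 0] division by [l] is impossible. The function is constantly 0, and any admissible
   level, here [r / 2] or [1], turns the hypothesis into the claim. *)
rewrite le_eqVlt => /predU1P[<- _|l0 [mL lL rL]].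
  split => [r s _ _ _|r z /andP[r0 r1] H|z H]; rewrite !mul0r//.
    have h0 : 0 < r / 2 < r by apply/andP; split; lra.
    by have := H _ h0; rewrite mul0r.
  have h0 : 0 < (1 : R) <= 1 by rewrite lexx ltr01.
  by have := H _ h0; rewrite mul0r.
split => [r s r0 rs s1|r z r01 H|z H] /=.
- by rewrite ler_pM2l//; exact: mL.
- rewrite -ler_pdivlMl//; apply: lL => // s sr.
  by rewrite ler_pdivlMl//; exact: H.
- rewrite -ler_pdivrMl//; apply: rL => // s sr.
  by rewrite ler_pdivrMl//; exact: H.
Qed.

(** Each condition is tested up to an arbitrary [e]: passing from [L] to an [e / 2]-close [L'] and
    back costs [e / 2] each way. *)
Lemma lower_end_ulim L :
  (forall e, 0 < e -> exists2 L', lower_end L' &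
     forall r, 0 <= r <= 1 -> `|L' r - L r| <= e) -> lower_end L.
Proof.
move=> H; split => [r s r0 rs s1|r z /andP[r0 r1] h|z h] /=.
- apply/ler_addgt0Pr => e e0; have e2 : 0 < e / 2 by rewrite divr_gt0.
  have [L' [mL' _ _] HL'] := H _ e2.
  have := mL' _ _ r0 rs s1.
  have := HL' r; rewrite r0 (le_trans rs)// => /(_ isT).
  have := HL' s; rewrite s1 (le_trans r0)// => /(_ isT).
  by rewrite !ler_norml => /andP[? ?] /andP[? ?] ?; lra.
- apply/ler_addgt0Pr => e e0; have e2 : 0 < e / 2 by rewrite divr_gt0.
  have [L' [_ lL' _] HL'] := H _ e2.
  have := HL' r; rewrite r1 (ltW r0) => /(_ isT); rewrite ler_norml => /andP[? ?].
  have : L' r <= z + e / 2.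
    apply: lL' => [|s /andP[s0 sr]]; first by rewrite r0.
    have s01 : 0 <= s <= 1 by rewrite (ltW s0) (ltW (lt_le_trans sr r1)).
    have := HL' s; rewrite s01 => /(_ isT).
    have := h s; rewrite s0 sr => /(_ isT).
    by rewrite ler_norml => ? /andP[? ?]; lra.
  by move=> ?; lra.
- apply/ler_addgt0Pr => e e0; have e2 : 0 < e / 2 by rewrite divr_gt0.
  have [L' [_ _ rL'] HL'] := H _ e2.
  have := HL' 0; rewrite lexx ler01 => /(_ isT); rewrite ler_norml => /andP[? ?].
  have : z - e / 2 <= L' 0.
    apply: rL' => s /andP[s0 s1].
    have s01 : 0 <= s <= 1 by rewrite (ltW s0) s1.
    have := HL' s; rewrite s01 => /(_ isT).
    have := h s; rewrite s0 s1 => /(_ isT).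
    by rewrite ler_norml => ? /andP[? ?]; lra.
  by move=> ?; lra.
Qed.

Lemma endpoints_le L U r : endpoints L U -> 0 <= r <= 1 -> L r <= U r.
Proof.
move=> [[mL _ _] [mU _ _] LU1] /andP[r0 r1].
rewrite (le_trans (mL _ _ r0 r1 (lexx _)))// (le_trans LU1)//.
by rewrite -lerN2; exact: mU.
Qed.

(** * From a pair of endpoint functions to a fuzzy number *)

Section from_levels_endpoints.
Variables (L U : R -> R) (A : R -> set R).
Hypothesis LU : endpoints L U.
Hypothesis AE : forall r, 0 < r <= 1 -> A r = [set x | L r <= x <= U r].

Let mL : forall r s, 0 <= r -> r <= s -> s <= 1 -> L r <= L s.
Proof. by case: LU => [[]]. Qed.

Let mU : forall r s, 0 <= r -> r <= s -> s <= 1 -> U s <= U r.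
Proof. by case: LU => [_ [mU _ _] _] r s r0 rs s1; rewrite -lerN2 mU. Qed.

Let has_sup_levels x :
  has_sup ([set r | 0 < r <= 1 /\ A r x] `|` [set 0]).
Proof.
split; first by exists 0; right.
by exists 1 => y /= [[/andP[]]|->].
Qed.

Lemma from_levels_ge0 x : 0 <= from_levels A x.
Proof. by apply: ub_le_sup; [case: (has_sup_levels x)|right]. Qed.

Lemma from_levels_le1 x : from_levels A x <= 1.
Proof.
apply: ge_sup; first by case: (has_sup_levels x).
by move=> y /= [[/andP[]]|->].
Qed.

(** The supremum need not be attained a priori, so [r <= from_levels A x] only places [x] in the
    intervals of levels [s < r]. Left-continuity of both endpoints carries this to level [r].
    Convexity, semicontinuity and the level sets below all follow from this equivalence. *)
Lemma from_levels_geE r x : 0 < r <= 1 ->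
  (r <= from_levels A x) = (L r <= x <= U r).
Proof.
move=> r01; have /andP[r0 r1] := r01; apply/idP/idP; last first.
  move=> h; apply: ub_le_sup; first by case: (has_sup_levels x).
  by left; split => //; rewrite AE.
move=> rx.
have H s : 0 < s < r -> L s <= x <= U s.
  move=> /andP[s0 sr].
  have [t + st] := sup_gt (has_sup_levels x).1 (lt_le_trans sr rx).
  move=> [[/andP[t0 t1]]|t0]; last by move: st; rewrite t0 ltNge ltW.
  rewrite AE ?t0// => /andP[Ltx xUt].
  by rewrite (le_trans (mL (ltW s0) (ltW st) t1) Ltx) (le_trans xUt)// mU// ltW.
case: LU => [[_ lL _] [_ lU _] _]; apply/andP; split.
  by apply: lL => // s /H /andP[].
by rewrite -lerN2; apply: lU => // s /H /andP[_]; rewrite lerN2.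
Qed.

Lemma level_from_levels r : 0 < r <= 1 ->
  level (from_levels A) r = [set` `[L r, U r]].
Proof.
move=> r01; rewrite /level gt_eqF; last by case/andP: r01.
by apply/seteqP; split => x /=; rewrite in_itv/= from_levels_geE.
Qed.

Let support_sub : [set x | 0 < from_levels A x] `<=` [set` `[L 0, U 0]].
Proof.
move=> x /= fx; have := from_levels_geE x (r := from_levels A x).
rewrite fx from_levels_le1 lexx => /(_ isT)/esym/andP[h1 h2].
have f1 := from_levels_le1 x.
by rewrite in_itv/= (le_trans (mL _ (ltW fx) f1) h1)// (le_trans h2)// mU// ltW.
Qed.

Let closure_support_sub :
  closure [set x | 0 < from_levels A x] `<=` [set` `[L 0, U 0]].
Proof.
by move=> x /(closureS support_sub); rewrite -(closure_id _).1//; exact: itv_closed.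
Qed.

Lemma is_fuzzy_from_levels : is_fuzzy (from_levels A).
Proof.
split.
- by move=> x; rewrite from_levels_ge0 from_levels_le1.
- exists (L 1); apply/le_anti; rewrite from_levels_le1 /=.
  by rewrite from_levels_geE ?ltr01 lexx//; case: LU.
- move=> x y t /andP[t0 t1].
  set m := Num.min _ _.
  have [m0|m0] := leP m 0; first by rewrite (le_trans m0)// from_levels_ge0.
  have m01 : 0 < m <= 1 by rewrite m0 ge_min from_levels_le1.
  have : m <= from_levels A x by rewrite ge_min lexx.
  have : m <= from_levels A y by rewrite ge_min lexx orbT.
  rewrite !from_levels_geE// => /andP[? ?] /andP[? ?].
  have t1' : 0 <= 1 - t by rewrite subr_ge0.
  have -> : L m = t * L m + (1 - t) * L m by rewrite -mulrDl addrC subrK mul1r.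
  have -> : U m = t * U m + (1 - t) * U m by rewrite -mulrDl addrC subrK mul1r.
  by rewrite !lerD// ler_wpM2l.
(* Upper semicontinuity: if the raised value exceeds 1 every point works. Otherwise [x] lies outside
   the closed interval of level [from_levels A x + e], whose complement is a neighbourhood of
   [x]. *)
- move=> x e e0; have [e1|e1] := leP (from_levels A x + e) 1; last first.
    have : nbhs x [set: R] by exact: filterT.
    by apply: filterS => y _; rewrite (le_lt_trans (from_levels_le1 _)).
  have r01 : 0 < from_levels A x + e <= 1 by rewrite e1 ltr_wpDl// from_levels_ge0.
  have : nbhs x (~` [set` `[L (from_levels A x + e), U (from_levels A x + e)]]).
    apply: open_nbhs_nbhs; split; first exact/closed_openC/itv_closed.
    by rewrite /= in_itv/= -from_levels_geE//; apply/negP; rewrite -ltNge ltrDl.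
  apply: filterS => y /=.
  by rewrite in_itv/= -from_levels_geE// => /negP; rewrite -ltNge.
- apply: (subclosed_compact _ (@segment_compact _ (L 0) (U 0))) => //.
  exact: closed_closure.
Qed.

Let support_L s : 0 < s <= 1 -> level (from_levels A) 0 (L s).
Proof.
move=> s01; rewrite /level eqxx; apply: subset_closure => /=.
apply: (@lt_le_trans _ _ s); first by case/andP: s01.
rewrite from_levels_geE// lexx endpoints_le//.
by case/andP: s01 => /ltW -> ->.
Qed.

Let support_U s : 0 < s <= 1 -> level (from_levels A) 0 (U s).
Proof.
move=> s01; rewrite /level eqxx; apply: subset_closure => /=.
apply: (@lt_le_trans _ _ s); first by case/andP: s01.
rewrite from_levels_geE// lexx endpoints_le//.
by case/andP: s01 => /ltW -> ->.
Qed.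

Let level0_sub : level (from_levels A) 0 `<=` [set` `[L 0, U 0]].
Proof. by rewrite /level eqxx. Qed.

(** Positive levels are explicit intervals. Level 0 is a closure, lying inside [[L 0, U 0]] and
    containing every [L s] with [0 < s <= 1], so right-continuity at 0 identifies its infimum. *)
Lemma lend_from_levels r : 0 <= r <= 1 -> lend (from_levels A) r = L r.
Proof.
rewrite le_eqVlt => /andP[/predU1P[<-|r0] r1]; last first.
  rewrite /lend level_from_levels ?r0// inf_itv// bnd_simp endpoints_le//.
  by rewrite ltW.
apply/le_anti/andP; split.
  case: LU => [[_ _ rL] _ _]; apply: rL => s s01.
  apply: ge_inf; last exact: support_L.
  by exists (L 0) => y /level0_sub/=; rewrite in_itv/= => /andP[].
apply: lb_le_inf; first by exists (L 1); apply: support_L; rewrite lexx ltr01.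
by move=> y /level0_sub/=; rewrite in_itv/= => /andP[].
Qed.

Lemma rend_from_levels r : 0 <= r <= 1 -> rend (from_levels A) r = U r.
Proof.
rewrite le_eqVlt => /andP[/predU1P[<-|r0] r1]; last first.
  rewrite /rend level_from_levels ?r0// sup_itv// bnd_simp endpoints_le//.
  by rewrite ltW.
apply/le_anti/andP; split.
  apply: ge_sup; first by exists (U 1); apply: support_U; rewrite lexx ltr01.
  by move=> y /level0_sub/=; rewrite in_itv/= => /andP[].
case: LU => [_ [_ _ rU] _]; rewrite -lerN2; apply: rU => s s01.
rewrite lerN2; apply: ub_le_sup; last exact: support_U.
by exists (U 0) => y /level0_sub/=; rewrite in_itv/= => /andP[].
Qed.

End from_levels_endpoints.

(** * From a fuzzy number to its endpoint functions *)

Definition level_family (S : R -> set R) : Prop :=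
  [/\ exists M, forall x, S 0 x -> `|x| <= M,
      S 1 !=set0,
      forall r s, 0 <= r -> r <= s -> s <= 1 -> S s `<=` S r,
      forall r, 0 < r <= 1 -> closed (S r) /\ is_interval (S r) &
      (forall r x, 0 < r <= 1 -> (forall s, 0 < s < r -> S s x) -> S r x) /\
      (forall C, closed C -> (forall s, 0 < s <= 1 -> S s `<=` C) -> S 0 `<=` C)].

(** The properties of [level_family] are symmetric under negation. As [inf] is defined as minus the
    [sup] of the negated set, every result on suprema of levels thereby yields the one on infima. *)
Lemma level_familyN S : level_family S -> level_family (fun r => -%R @` S r).
Proof.
have NE (A : set R) x : (-%R @` A) x <-> A (- x).
  by split => [[y Ay <-]|Ax]; [rewrite opprK|exists (- x); rewrite ?opprK].
have Ncl (A : set R) : closed A -> closed (-%R @` A).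
  move=> cA; rewrite (_ : _ @` A = -%R @^-1` A); last first.
    by apply/seteqP; split => x /NE.
  by apply: preimage_closed => // x _; exact: continuousN.
move=> [[M SM] [x0 Sx0] mS cS [iS zS]]; split.
- by exists M => x /NE /SM; rewrite normrN.
- by exists (- x0); apply/NE; rewrite opprK.
- by move=> r s r0 rs s1 x /NE /(mS _ _ r0 rs s1) /NE.
- move=> r r01; have [cSr ciSr] := cS r r01; split; first exact: Ncl.
  move=> x y /NE Sx /NE Sy z /andP[xz zy]; apply/NE; apply: (ciSr _ _ Sy Sx).
  by rewrite !lerN2 zy.
- split => [r x r01 H|C cC H].
    by apply/NE; apply: iS => // s /H /NE.
  move=> x /NE Sx; rewrite -[x]opprK; apply/(NE C).
  apply: zS Sx; first exact: Ncl.
  by move=> s s01 y Sy; apply/NE; apply: (H s s01); apply/NE; rewrite opprK.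
Qed.

Section level_family_sup.
Variable S : R -> set R.
Hypothesis HS : level_family S.

Lemma level_family_has_sup r : 0 <= r <= 1 -> has_sup (S r).
Proof.
case: HS => [[M SM] [x0 Sx0] mS _ _] /andP[r0 r1]; split.
  by exists x0; exact: mS Sx0.
by exists M => x /(mS 0 r (lexx _) r0 r1) /SM; apply: le_trans; rewrite ler_norm.
Qed.

Lemma level_family_sup r : 0 < r <= 1 -> S r (sup (S r)).
Proof.
move=> r01; case: HS => _ _ _ /(_ _ r01)[cS _] _.
have r01' : 0 <= r <= 1 by case/andP: r01 => /ltW -> ->.
by have [S0 uS] := level_family_has_sup r01'; apply/cS/closure_sup.
Qed.

Lemma lower_end_sup : lower_end (fun r => - sup (S r)).
Proof.
have hs := level_family_has_sup.
case: (HS) => [[M SM] [x0 Sx0] mS cS [iS zS]]; split.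
- move=> r s r0 rs s1; rewrite lerN2; apply: ge_sup.
    by apply: (hs _ _).1; rewrite s1 (le_trans r0).
  move=> x Sx; apply: ub_le_sup; last exact: (mS r s).
  by apply: (hs _ _).2; rewrite r0 (le_trans rs).
(* Left-continuity: if [sup (S r) < - z], then for each [s < r] the point [- z] lies between
   [sup (S r)] and [sup (S s)], both in the interval [S s]. Hence [- z] is in [S r], a
   contradiction. *)
- move=> r z r01 H; rewrite lerNl leNgt; apply/negP => zr.
  have [r0 r1] := andP r01.
  have : S r (- z).
    apply: iS => // s /andP[s0 sr].
    have s01 : 0 < s <= 1 by rewrite s0 (le_trans (ltW sr)).
    have [_ iSs] := cS _ s01; apply: (iSs (sup (S r)) (sup (S s))).
    + by apply: (mS s r) => //; [exact: ltW|exact: ltW|exact: level_family_sup].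
    + exact: level_family_sup.
    + by rewrite ltW//= lerNl; apply: H; rewrite s0.
  have r01' : 0 <= r <= 1 by rewrite (ltW r0) r1.
  by move=> /(ub_le_sup (hs _ r01').2); rewrite leNgt zr.
- move=> z H; rewrite lerNr; apply: ge_sup.
    by apply: (hs _ _).1; rewrite lexx ler01.
  (* The closed half-line bounded by [- z] contains all positive levels, hence also level 0. *)
  apply: (zS [set` `]-oo, (- z)]]) => [|s s01 x Sx /=]; first exact: interval_closed.
  rewrite in_itv/= lerNr (le_trans (H s s01))// lerN2.
  by apply: ub_le_sup => //; apply: (hs _ _).2; case/andP: s01 => /ltW -> ->.
Qed.

End level_family_sup.

Section fuzzy_number.
Variable u : R -> R.
Hypothesis fu : is_fuzzy u.

Lemma level_family_fuzzy : level_family (level u).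
Proof.
case: fu => u01 [x0 ux0] cu su ku.
have lvE r : 0 < r <= 1 -> level u r = [set x | r <= u x].
  by move=> /andP[r0 _]; rewrite /level gt_eqF.
split.
- have [M [_ HM]] := compact_bounded ku.
  exists (M + 1) => x; rewrite /level eqxx => ux.
  by apply: (HM (M + 1) _ x ux); rewrite ltrDl ltr01.
- by exists x0; rewrite lvE ?lexx ?ltr01//= ux0 lexx.
- move=> r s + + s1 x; rewrite le_eqVlt => /predU1P[<-|r0 rs].
    rewrite le_eqVlt => /predU1P[<-//|s0].
    rewrite (lvE s) ?s0//= => sx; rewrite /level eqxx; apply: subset_closure => /=.
    exact: lt_le_trans sx.
  have s0 := lt_le_trans r0 rs.
  have r1 := le_trans rs s1.
  by rewrite !lvE ?r0 ?s0//=; exact: le_trans rs.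
- move=> r r01; rewrite lvE//; split.
    rewrite -openC openE => x /= /negP; rewrite -ltNge => uxr.
    have := su x (r - u x); rewrite subr_gt0 => /(_ uxr).
    by apply: filterS => y; rewrite addrC subrK => uyr /=; apply/negP; rewrite -ltNge.
  move=> x y /= rx ry z /andP[xz zy].
  have [xy|xy] := eqVneq x y.
    by have -> // : z = x by apply/le_anti; rewrite xz {1}xy zy.
  have xy' : 0 < y - x by rewrite subr_gt0 lt_neqAle xy (le_trans xz).
  (* This weight writes [z] as a convex combination of [x] and [y]. *)
  have := cu x y ((y - z) / (y - x)).
  have -> : (y - z) / (y - x) * x + (1 - (y - z) / (y - x)) * y = z.
    by field; rewrite gt_eqF.
  rewrite divr_ge0 ?(ltW xy') ?subr_ge0//= ler_pdivrMr// mul1r lerD2l lerN2.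
  by move=> /(_ xz); apply: le_trans; rewrite le_min rx.
- split => [r x r01 H|C cC H].
    rewrite lvE//= leNgt; apply/negP => xr.
    have [r0 r1] := andP r01.
    have [ux0'|ux0'] := leP (u x) 0.
      have := H (r / 2); rewrite lvE; last by apply/andP; split; lra.
      rewrite /= => /(_ ltac:(by apply/andP; split; lra)); lra.
    have := H ((r + u x) / 2); rewrite lvE; last by apply/andP; split; lra.
    by rewrite /= => /(_ ltac:(by apply/andP; split; lra)); lra.
  rewrite /level eqxx [X in _ `<=` X](closure_id _).1//.
  (* A point of the support lies in the level indexed by its own membership degree. *)
  apply: closureS => x /= ux.
  have h : 0 < u x <= 1 by rewrite ux; case/andP: (u01 x).
  by apply: (H _ h); rewrite lvE/=.
Qed.

Lemma endpoints_fuzzy : endpoints (lend u) (rend u).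
Proof.
split; first exact: lower_end_sup (level_familyN level_family_fuzzy).
  exact: lower_end_sup level_family_fuzzy.
have h01 : 0 <= (1 : R) <= 1 by rewrite ler01 lexx.
have [x0 ux0] := (level_family_has_sup level_family_fuzzy h01).1.
apply: (@le_trans _ _ x0).
  rewrite /lend /inf lerNl; apply: ub_le_sup; last by exists x0.
  exact: (level_family_has_sup (level_familyN level_family_fuzzy) h01).2.
apply: ub_le_sup => //.
exact: (level_family_has_sup level_family_fuzzy h01).2.
Qed.

(** A positive level is a closed bounded interval, so it contains its infimum and its supremum, and
    everything in between. *)
Lemma level_fuzzy r : 0 < r <= 1 -> level u r = [set x | lend u r <= x <= rend u r].
Proof.
move=> r01; have r01' : 0 <= r <= 1 by case/andP: r01 => /ltW -> ->.
have HS := level_family_fuzzy; have HN := level_familyN HS.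
apply/seteqP; split => x /=.
  move=> ux; apply/andP; split; last first.
    by apply: ub_le_sup => //; exact: (level_family_has_sup HS r01').2.
  rewrite /lend /inf lerNl; apply: ub_le_sup; last by exists x.
  exact: (level_family_has_sup HN r01').2.
have [y uy yE] := level_family_sup HN r01.
have z := level_family_sup HS r01.
case: HS => _ _ _ /(_ _ r01)[_ iS] _; apply: iS => //.
by rewrite /lend /inf -yE opprK.
Qed.

(** Both functions satisfy [r <= _] at the same points for every [r] in (0, 1]. Taking [r] to be the
    value of one of them gives each inequality. *)
Lemma fuzzyE : u = from_levels (fun r => [set x | lend u r <= x <= rend u r]).
Proof.
apply/funext => x; case: fu => u01 _ _ _ _; have /andP[u0 u1] := u01 x.
have lu := endpoints_fuzzy.
have ge r : 0 < r <= 1 -> (r <= u x) = (lend u r <= x <= rend u r).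
  move=> r01; have := level_fuzzy r01; rewrite /level gt_eqF; last by case/andP: r01.
  by move=> /(congr1 (@^~ x)) /= e; apply/idP/idP; rewrite e.
set w := from_levels _.
have wge r : 0 < r <= 1 -> (r <= w x) = (lend u r <= x <= rend u r).
  by move=> r01; apply: from_levels_geE.
have w0 : 0 <= w x by apply: from_levels_ge0.
have w1 : w x <= 1 by apply: from_levels_le1.
apply/le_anti/andP; split.
- have [ux0|u0'] := leP (u x) 0; first exact: le_trans w0.
  by rewrite wge ?u0' ?u1// -ge ?u0' ?u1.
- have [wx0|w0'] := leP (w x) 0; first exact: le_trans u0.
  by rewrite ge ?w0' ?w1// -wge ?w0' ?w1.
Qed.

End fuzzy_number.
End Endpoints.


(** * The metric [fD] on fuzzy numbers *)

Section fuzzy_distance.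
Variable R : realType.
Implicit Types (u v w : R -> R) (r s c : R).

Lemma lower_end_cst c : lower_end (fun=> c).
Proof.
split => [//|r z /andP[r0 r1] H|z H].
  by apply: (H (r / 2)); apply/andP; split; lra.
by apply: (H 1); rewrite lexx ltr01.
Qed.

Lemma endpoints0 : endpoints (fun _ : R => 0) (fun _ => 0).
Proof.
split => //; first exact: lower_end_cst.
by rewrite (_ : \- _ = fun=> - 0); [exact: lower_end_cst|exact/funext].
Qed.

Lemma fzeroE : fzero = from_levels (fun r => [set x : R | 0 <= x <= 0]).
Proof.
apply/funext => x; rewrite /fzero /from_levels; apply/esym.
have xE : (0 <= x <= 0) = (x == 0) by rewrite eq_le andbC.
case: eqP => [->|/eqP x0].
  apply/le_anti/andP; split.
    by apply: ge_sup => [|y /= [[/andP[]]//|->//]]; exists 0; right.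
  apply: ub_le_sup; first by exists 1 => y /= [[/andP[]]//|->//].
  by left; rewrite /= !lexx ltr01.
rewrite [X in sup X](_ : _ = [set 0]) ?sup1//.
apply/seteqP; split => y /=; last by move=> ->; right.
by case=> // -[_]; rewrite xE (negbTE x0).
Qed.

Lemma is_fuzzy_fzero : is_fuzzy (@fzero R).
Proof. by rewrite fzeroE; exact: is_fuzzy_from_levels endpoints0 _. Qed.

Lemma lend_fzero r : 0 <= r <= 1 -> lend fzero r = 0.
Proof. by move=> r01; rewrite fzeroE (lend_from_levels endpoints0). Qed.

Lemma rend_fzero r : 0 <= r <= 1 -> rend fzero r = 0.
Proof. by move=> r01; rewrite fzeroE (rend_from_levels endpoints0). Qed.

Lemma fD_has_sup u v : is_fuzzy u -> is_fuzzy v ->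
  has_sup [set Num.max `|lend u r - lend v r| `|rend u r - rend v r| | r in `[0, 1]].
Proof.
move=> fu fv; split.
  by eexists; exists 0 => //=; rewrite in_itv/= lexx ler01.
have bnd L U : endpoints L U -> exists M, forall r, 0 <= r <= 1 ->
    `|L r| <= M /\ `|U r| <= M.
  move=> [[mL _ _] [mU _ _] _].
  (* Monotone functions on [0, 1] lie between their values at 0 and 1. *)
  exists (`|L 0| + `|L 1| + `|U 0| + `|U 1|) => r /andP[r0 r1].
  have := mL _ _ (lexx _) r0 r1; have := mL _ _ r0 r1 (lexx _).
  have := mU _ _ (lexx _) r0 r1; have := mU _ _ r0 r1 (lexx _).
  have := normr_ge0 (L 0); have := normr_ge0 (L 1).
  have := normr_ge0 (U 0); have := normr_ge0 (U 1).
  have := ler_norm (L 1); have := ler_norm (U 0).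
  have := ler_norm (- L 0); have := ler_norm (- U 1); rewrite /= !normrN.
  by move=> *; rewrite !ler_norml; split; apply/andP; split; lra.
have [Mu HMu] := bnd _ _ (endpoints_fuzzy fu).
have [Mv HMv] := bnd _ _ (endpoints_fuzzy fv).
exists (Mu + Mv) => x [r] /=; rewrite in_itv/= => r01 <-.
have [ul ur] := HMu _ r01; have [vl vr] := HMv _ r01.
by rewrite ge_max !(le_trans (ler_normB _ _))// lerD.
Qed.

Lemma fD_lend u v r : is_fuzzy u -> is_fuzzy v -> 0 <= r <= 1 ->
  `|lend u r - lend v r| <= fD u v.
Proof.
move=> fu fv r01.
rewrite (@le_trans _ _ (Num.max `|lend u r - lend v r| `|rend u r - rend v r|))//.
  by rewrite le_max lexx.
by apply: ub_le_sup; [exact: (fD_has_sup fu fv).2|exists r].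
Qed.

Lemma fD_rend u v r : is_fuzzy u -> is_fuzzy v -> 0 <= r <= 1 ->
  `|rend u r - rend v r| <= fD u v.
Proof.
move=> fu fv r01.
rewrite (@le_trans _ _ (Num.max `|lend u r - lend v r| `|rend u r - rend v r|))//.
  by rewrite le_max lexx orbT.
by apply: ub_le_sup; [exact: (fD_has_sup fu fv).2|exists r].
Qed.

Lemma fD_le u v c :
  (forall r, 0 <= r <= 1 ->
     `|lend u r - lend v r| <= c /\ `|rend u r - rend v r| <= c) ->
  fD u v <= c.
Proof.
move=> H; apply: ge_sup.
  by eexists; exists 0 => //=; rewrite in_itv/= lexx ler01.
by move=> x [r] /=; rewrite in_itv/= => /H[h1 h2] <-; rewrite ge_max h1.
Qed.

Lemma fD_ge0 u v : is_fuzzy u -> is_fuzzy v -> 0 <= fD u v.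
Proof.
move=> fu fv; apply: le_trans (fD_lend (r := 0) fu fv _); first exact: normr_ge0.
by rewrite lexx ler01.
Qed.

Lemma fDC u v : fD u v = fD v u.
Proof.
rewrite /fD; congr sup; apply: eq_imagel => r _.
by rewrite distrC [X in Num.max _ X]distrC.
Qed.

Lemma fDxx u : is_fuzzy u -> fD u u = 0.
Proof.
move=> fu; apply/le_anti; rewrite fD_ge0// andbT.
by apply: fD_le => r _; rewrite !subrr normr0.
Qed.

Lemma fD_triangle u v w : is_fuzzy u -> is_fuzzy v -> is_fuzzy w ->
  fD u w <= fD u v + fD v w.
Proof.
move=> fu fv fw; apply: fD_le => r r01; split.
- by rewrite (le_trans (ler_distD (lend v r) _ _))// lerD// fD_lend.
- by rewrite (le_trans (ler_distD (rend v r) _ _))// lerD// fD_rend.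
Qed.

Lemma fuzzy_eq_ends u v : is_fuzzy u -> is_fuzzy v ->
  (forall r, 0 <= r <= 1 -> lend u r = lend v r /\ rend u r = rend v r) -> u = v.
Proof.
move=> fu fv uv; rewrite (fuzzyE fu) (fuzzyE fv).
apply/funext => x; rewrite /from_levels; congr (sup (_ `|` _)).
apply/seteqP; split => r /= [r01 rx]; split => //; move: rx;
  by have [|-> ->] := uv r; first by case/andP: r01 => /ltW -> ->.
Qed.

Lemma fD_eq0 u v : is_fuzzy u -> is_fuzzy v -> fD u v = 0 -> u = v.
Proof.
move=> fu fv uv0; apply: fuzzy_eq_ends => // r r01.
have := fD_lend fu fv r01; have := fD_rend fu fv r01.
by rewrite uv0 !normr_le0 !subr_eq0 => /eqP-> /eqP->.
Qed.

(** * Sums and scalar multiples, and how [fD] behaves under them *)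

Lemma fadd_ends u v : is_fuzzy u -> is_fuzzy v ->
  is_fuzzy (fadd u v) /\ forall r, 0 <= r <= 1 ->
    lend (fadd u v) r = lend u r + lend v r /\
    rend (fadd u v) r = rend u r + rend v r.
Proof.
move=> fu fv; have [Lu Uu LUu] := endpoints_fuzzy fu.
have [Lv Uv LUv] := endpoints_fuzzy fv.
have E : endpoints (lend u \+ lend v) (rend u \+ rend v).
  split; first exact: lower_endD.
    rewrite (_ : \- _ = (\- rend u) \+ (\- rend v)); first exact: lower_endD.
    by apply/funext => r /=; rewrite opprD.
  exact: lerD.
have AE r : 0 < r <= 1 ->
    [set z | exists x y, [/\ level u r x, level v r y & z = x + y]] =
    [set x | (lend u \+ lend v) r <= x <= (rend u \+ rend v) r].
  move=> r01; rewrite (level_fuzzy fu r01) (level_fuzzy fv r01).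
  apply/seteqP; split => z /=.
    by move=> [x [y [/andP[? ?] /andP[? ?] ->]]]; rewrite !lerD.
  move=> /andP[h1 h2].
  have r01' : 0 <= r <= 1 by case/andP: r01 => /ltW -> ->.
  have lu := endpoints_le (endpoints_fuzzy fu) r01'.
  have lv := endpoints_le (endpoints_fuzzy fv) r01'.
  (* To split [z], take the largest [y], namely [rend v r], if this leaves a remainder at least
     [lend u r]. Otherwise take [x = lend u r], and the remaining [y] is below [rend v r]. *)
  have [h|h] := leP (lend u r) (z - rend v r).
    by exists (z - rend v r), (rend v r); split; [lra|lra|rewrite subrK].
  by exists (lend u r), (z - lend u r); split; [lra|lra|rewrite addrC subrK].
split; first exact: is_fuzzy_from_levels E AE.
move=> r r01; split; first exact: lend_from_levels E AE _ r01.
exact: rend_from_levels E AE _ r01.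
Qed.

Lemma fscale_ends l u : is_fuzzy u ->
  is_fuzzy (fscale l u) /\ forall r, 0 <= r <= 1 ->
    lend (fscale l u) r = l * (if 0 <= l then lend u r else rend u r) /\
    rend (fscale l u) r = l * (if 0 <= l then rend u r else lend u r).
Proof.
move=> fu; have [Lu Uu LUu] := endpoints_fuzzy fu.
set L := fun r => l * (if 0 <= l then lend u r else rend u r).
set U := fun r => l * (if 0 <= l then rend u r else lend u r).
have E : endpoints L U.
  rewrite /L /U; have [l0|l0] := leP 0 l.
    split; first exact: lower_endZ.
      rewrite (_ : \- _ = fun r => l * (\- rend u) r); first exact: lower_endZ.
      by apply/funext => r /=; rewrite mulrN.
    by rewrite ler_wpM2l.
  have Nl0 : 0 <= - l by rewrite oppr_ge0 ltW.
  split.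
  - rewrite (_ : (fun _ => _) = fun r => (- l) * (\- rend u) r); first exact: lower_endZ.
    by apply/funext => r /=; rewrite mulrNN.
  - rewrite (_ : \- _ = fun r => (- l) * lend u r); first exact: lower_endZ.
    by apply/funext => r /=; rewrite mulNr.
  - by rewrite ler_nM2l.
have AE r : 0 < r <= 1 ->
    [set z | exists x, level u r x /\ z = l * x] = [set x | L r <= x <= U r].
  move=> r01; rewrite (level_fuzzy fu r01).
  have r01' : 0 <= r <= 1 by case/andP: r01 => /ltW -> ->.
  have lu := endpoints_le (endpoints_fuzzy fu) r01'.
  apply/seteqP; split => z /=; rewrite /L /U.
    move=> [x [/andP[h1 h2] ->]]; have [l0|l0] := leP 0 l.
      by rewrite !ler_wpM2l.
    by rewrite !ler_nM2l// h1 h2.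
  (* For [l = 0] the scaled level is the single point 0, and any point of the level of [u] is a
     preimage. Otherwise the preimage is [z / l]. *)
  have [->|lN0] := eqVneq l 0.
    rewrite lexx !mul0r => z0; exists (lend u r); rewrite lexx lu mul0r; split => //.
    by apply/esym/le_anti.
  move=> h; exists (z / l); rewrite mulrCA divff// mulr1; split => //; move: h.
  have [l0|l0] := leP 0 l.
    have l0' : 0 < l by rewrite lt_neqAle eq_sym lN0.
    by rewrite ler_pdivlMr// ler_pdivrMr// ![l * _]mulrC.
  by rewrite ler_ndivlMr// ler_ndivrMr// ![l * _]mulrC andbC.
split; first exact: is_fuzzy_from_levels E AE.
move=> r r01; split; first exact: lend_from_levels E AE _ r01.
exact: rend_from_levels E AE _ r01.
Qed.

Lemma fD_faddr u v w : is_fuzzy u -> is_fuzzy v -> is_fuzzy w ->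
  fD (fadd u w) (fadd v w) = fD u v.
Proof.
move=> fu fv fw; rewrite /fD; congr sup; apply: eq_imagel => r /=.
rewrite in_itv/= => r01.
have [-> ->] := (fadd_ends fu fw).2 _ r01.
have [-> ->] := (fadd_ends fv fw).2 _ r01.
have E x y z : x + z - (y + z) = x - y :> R by ring.
by rewrite !E.
Qed.

Lemma fD_fadd u v w t : is_fuzzy u -> is_fuzzy v -> is_fuzzy w -> is_fuzzy t ->
  fD (fadd u v) (fadd w t) <= fD u w + fD v t.
Proof.
move=> fu fv fw ft; apply: fD_le => r r01.
have [-> ->] := (fadd_ends fu fv).2 _ r01.
have [-> ->] := (fadd_ends fw ft).2 _ r01.
have E (a b c d M N : R) : `|a - c| <= M -> `|b - d| <= N ->
    `|(a + b) - (c + d)| <= M + N.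
  by move=> ? ?; rewrite opprD addrACA (le_trans (ler_normD _ _))// lerD.
by split; apply: E; rewrite ?fD_lend ?fD_rend.
Qed.

Lemma fD_fscale l u v : is_fuzzy u -> is_fuzzy v ->
  fD (fscale l u) (fscale l v) = `|l| * fD u v.
Proof.
move=> fu fv; have [fu' lu] := fscale_ends l fu; have [fv' lv] := fscale_ends l fv.
apply/le_anti/andP; split.
  apply: fD_le => r r01; have [-> ->] := lu _ r01; have [-> ->] := lv _ r01.
  by case: ifP => _; rewrite -!mulrBr !normrM !ler_wpM2l// ?fD_lend ?fD_rend.
have [l0|l0] := eqVneq l 0; first by have := fD_ge0 fu' fv'; rewrite l0 normr0 mul0r.
have nl0 : 0 < `|l| by rewrite normr_gt0.
rewrite -ler_pdivlMl//; apply: fD_le => r r01.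
have := fD_lend fu' fv' r01; have := fD_rend fu' fv' r01.
have [-> ->] := lu _ r01; have [-> ->] := lv _ r01.
by case: ifP => _; rewrite -!mulrBr !normrM !ler_pdivlMl// => -> ->.
Qed.

(** * Completeness of [fD] *)

Lemma fD_complete (u : nat -> R -> R) : (forall n, is_fuzzy (u n)) ->
  (forall e, 0 < e -> exists N, forall m n, (N <= m)%N -> (N <= n)%N ->
     fD (u m) (u n) <= e) ->
  exists2 w, is_fuzzy w & forall e, 0 < e -> exists N, forall n, (N <= n)%N ->
     fD (u n) w <= e.
Proof.
move=> fu cu.
have cv (E : (R -> R) -> R) :
    (forall m n, `|E (u m) - E (u n)| <= fD (u m) (u n)) -> cvgn (E \o u).
  move=> HE; apply/cauchy_cvgP/cauchy_ballP => e e0.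
  have e2 : 0 < e / 2 by rewrite divr_gt0.
  have [N HN] := cu _ e2; near_simpl.
  exists ([set n | (N <= n)%N], [set n | (N <= n)%N]).
    by split; exists N.
  move=> [m n] /= [Nm Nn]; rewrite /ball/= (le_lt_trans (HE m n))//.
  by rewrite (le_lt_trans (HN _ _ Nm Nn))// ltr_pdivrMr// mulr_natr mulr2n ltrDl.
set L := fun r => limn (fun n => lend (u n) r).
set U := fun r => limn (fun n => rend (u n) r).
have cL r : 0 <= r <= 1 -> (fun n => lend (u n) r) @ \oo --> L r.
  by move=> r01; apply: (cv (fun w => lend w r)) => m n; exact: fD_lend.
have cU r : 0 <= r <= 1 -> (fun n => rend (u n) r) @ \oo --> U r.
  by move=> r01; apply: (cv (fun w => rend w r)) => m n; exact: fD_rend.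
have bnd (x : nat -> R) y e m N : x @ \oo --> y ->
    (forall n, (N <= n)%N -> `|x m - x n| <= e) -> `|x m - y| <= e.
  move=> xy He; have cx : (fun n => `|x m - x n|) @ \oo --> `|x m - y|.
    by apply: cvg_norm; apply: cvgB => //; exact: cvg_cst.
  rewrite -(cvg_lim (@Rhausdorff R) cx); apply: limr_le; first exact: cvgP cx.
  by exists N => // n /= /He.
have ucL e : 0 < e -> exists N, forall n, (N <= n)%N -> forall r, 0 <= r <= 1 ->
    `|lend (u n) r - L r| <= e /\ `|rend (u n) r - U r| <= e.
  move=> /cu[N HN]; exists N => m Nm r r01; split.
    apply: (bnd _ _ _ _ N (cL _ r01)) => n Nn.
    exact: le_trans (fD_lend _ _ r01) (HN _ _ Nm Nn).
  apply: (bnd _ _ _ _ N (cU _ r01)) => n Nn.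
  exact: le_trans (fD_rend _ _ r01) (HN _ _ Nm Nn).
(* The estimate [ucL] is uniform in the level, which is what lets the limits inherit the one-sided
   continuity conditions. *)
have E : endpoints L U.
  split.
  - apply: lower_end_ulim => e /ucL[N HN]; exists (lend (u N)).
      by have [] := endpoints_fuzzy (fu N).
    by move=> r /(HN _ (leqnn _)) [].
  - apply: lower_end_ulim => e /ucL[N HN]; exists (\- rend (u N)).
      by have [] := endpoints_fuzzy (fu N).
    by move=> r /(HN _ (leqnn _)) [_]; rewrite /= -opprD normrN.
  - have o01 : 0 <= (1 : R) <= 1 by rewrite ler01 lexx.
    apply: ler_lim; [exact: cvgP (cL _ o01)|exact: cvgP (cU _ o01)|].
    by apply: nearW => n; have [] := endpoints_fuzzy (fu n).
exists (from_levels (fun r => [set x | L r <= x <= U r])).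
  exact: is_fuzzy_from_levels E _.
move=> e /ucL[N HN]; exists N => n Nn; apply: fD_le => r r01.
by rewrite (lend_from_levels E)// (rend_from_levels E)//; exact: HN.
Qed.

Lemma fD_dist (a b c : R -> R) : is_fuzzy a -> is_fuzzy b -> is_fuzzy c ->
  `|fD a b - fD a c| <= fD b c.
Proof.
move=> fa fb fc; have := fD_triangle fa fb fc; have := fD_triangle fa fc fb.
by rewrite [fD c b]fDC ler_norml => *; apply/andP; split; lra.
Qed.

(** The increments are summable, so the sequence is Cauchy. The bound is kept in telescoping form,
    using that [C / 2 ^+ n] is [2 * C / 2 ^+ n] minus its successor. *)
Lemma fD_geometric_cvg (w : nat -> R -> R) C : (forall n, is_fuzzy (w n)) ->
  (forall n, fD (w n) (w n.+1) <= C / 2 ^+ n) ->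
  exists2 l, is_fuzzy l & (fun n => fD (w n) l) @ \oo --> 0.
Proof.
move=> fw wC.
have C0 : 0 <= C.
  by have := wC 0%N; rewrite expr0 divr1; apply: le_trans; exact: fD_ge0.
have tail k j : fD (w k) (w (k + j)%N) <= 2 * C / 2 ^+ k - 2 * C / 2 ^+ (k + j).
  elim: j => [|j IH]; first by rewrite addn0 fDxx// subrr.
  rewrite addnS (le_trans (fD_triangle (fw _) (fw (k + j)%N) (fw _)))//.
  apply: (le_trans (lerD IH (wC _))).
  suff -> : C / 2 ^+ (k + j) = 2 * C / 2 ^+ (k + j) - 2 * C / 2 ^+ (k + j).+1.
    by rewrite addrA subrK.
  by rewrite exprS; field; rewrite expf_neq0.
have {}tail k m : (k <= m)%N -> fD (w k) (w m) <= 2 * C / 2 ^+ k.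
  move=> km; have := tail k (m - k)%N; rewrite subnKC//; move=> /le_trans; apply.
  by rewrite gerBl divr_ge0 ?mulr_ge0// exprn_ge0.
have [e e0|l fl wl] := fD_complete fw.
  (* The factor 4 comes from comparing both terms with [w N], each at distance at most
     [2 * C / 2 ^+ N]. *)
  have [N HN] : exists N, 4 * C / 2 ^+ N <= e.
    exists (Num.bound (4 * C / e)).
    rewrite ler_pdivrMr ?exprn_gt0// -ler_pdivrMl// [leLHS]mulrC.
    have h : 0 <= 4 * C / e by rewrite divr_ge0 ?mulr_ge0// ltW.
    rewrite (le_trans (ltW (archi_boundP h)))// -natrX ler_nat ltnW//.
    exact: ltn_expl.
  exists N => m n Nm Nn; rewrite (le_trans _ HN)//.
  rewrite (le_trans (fD_triangle (fw m) (fw N) (fw n)))// fDC.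
  have := tail _ _ Nm; have := tail _ _ Nn.
  have -> : 4 * C / 2 ^+ N = 2 * C / 2 ^+ N + 2 * C / 2 ^+ N by field; rewrite expf_neq0.
  by move=> *; exact: lerD.
exists l => //; apply/cvgrPdist_le => e /wl[N HN].
by exists N => // n /= /HN; rewrite sub0r normrN ger0_norm ?fD_ge0.
Qed.

End fuzzy_distance.

(** * Reduction of [fD] to rational levels *)

Section urat.
Variable R : realType.

(* An enumeration, with repetitions, of the rationals of [0, 1]. *)
Definition urat (n : nat) : R :=
  Num.min 1 (Num.max 0 (ratr (odflt 0 (unpickle n)))).

Lemma urat01 n : 0 <= urat n <= 1.
Proof. by rewrite /urat le_min ler01 le_max lexx ge_min lexx. Qed.

Lemma urat_dense (s r : R) : 0 <= s -> s < r -> r <= 1 ->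
  exists n, s < urat n < r.
Proof.
move=> s0 sr r1; have [q] := rat_in_itvoo sr; rewrite in_itv/= => /andP[sq qr].
exists (pickle q); rewrite /urat pickleK/=.
by rewrite max_r ?min_r ?sq// ltW// ?(lt_le_trans qr)// (le_lt_trans s0).
Qed.

(** For [s < r] pick a rational level [q] between them. Monotonicity gives
    [L s <= L q <= L' q + c <= L' r + c], and left-continuity replaces [L s] by [L r]. Level 0 is
    itself rational. *)
Lemma fD_le_urat (u v : R -> R) c : is_fuzzy u -> is_fuzzy v ->
  (forall n, `|lend u (urat n) - lend v (urat n)| <= c /\
             `|rend u (urat n) - rend v (urat n)| <= c) ->
  fD u v <= c.
Proof.
move=> fu fv H.
have H0 : `|lend u 0 - lend v 0| <= c /\ `|rend u 0 - rend v 0| <= c.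
  have := H (pickle (0 : rat)).
  rewrite (_ : urat _ = 0)//; rewrite /urat pickleK/= rmorph0 maxxx.
  by rewrite min_r ?ler01.
have aux L L' r : lower_end L -> lower_end L' -> 0 < r <= 1 ->
    (forall n, `|L (urat n) - L' (urat n)| <= c) -> L r <= L' r + c.
  move=> [mL lL _] [mL' _ _] /andP[r0 r1] h; apply: lL; first by rewrite r0.
  move=> s /andP[s0 sr]; have [n /andP[sn nr]] := urat_dense (ltW s0) sr r1.
  have /andP[n0 n1] := urat01 n.
  have := h n; rewrite ler_norml => /andP[_].
  have := mL _ _ (ltW s0) (ltW sn) n1; have := mL' _ _ n0 (ltW nr) r1.
  by move=> *; lra.
apply: fD_le => r; rewrite le_eqVlt => /andP[/predU1P[<-//|r0] r1].
have r01 : 0 < r <= 1 by rewrite r0.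
have [Lu Uu _] := endpoints_fuzzy fu; have [Lv Uv _] := endpoints_fuzzy fv.
have hN n : `|(\- rend u) (urat n) - (\- rend v) (urat n)| <= c.
  by rewrite /= -opprD normrN; have [] := H n.
have hN' n : `|(\- rend v) (urat n) - (\- rend u) (urat n)| <= c.
  by rewrite distrC.
have h n : `|lend u (urat n) - lend v (urat n)| <= c by have [] := H n.
have h' n : `|lend v (urat n) - lend u (urat n)| <= c by rewrite distrC.
have := aux _ _ _ Lu Lv r01 h; have := aux _ _ _ Lv Lu r01 h'.
have := aux _ _ _ Uu Uv r01 hN; have := aux _ _ _ Uv Uu r01 hN'.
rewrite /=; move: (lend u r) (lend v r) (rend u r) (rend v r) => x y z t *.
by rewrite !ler_norml; split; apply/andP; split; lra.
Qed.

(** The supremum is written as [sups _ 0], the supremum of the whole sequence, to match the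
    measurability of countable suprema. The upper bound is the side condition of that result. *)
Lemma fD_sups (u v : R -> R) : is_fuzzy u -> is_fuzzy v ->
  has_ubound (range (fun n => Num.max `|lend u (urat n) - lend v (urat n)|
                                      `|rend u (urat n) - rend v (urat n)|)) /\
  fD u v = sups (fun n => Num.max `|lend u (urat n) - lend v (urat n)|
                                  `|rend u (urat n) - rend v (urat n)|) 0%N.
Proof.
move=> fu fv; set h := fun n => _.
have hD n : h n <= fD u v by rewrite ge_max fD_lend ?fD_rend ?urat01.
have ubh : has_ubound (range h) by exists (fD u v) => _ [n _ <-].
split=> //; rewrite /sups/=.
have -> : sdrop h 0 = range h by apply/seteqP; split => x [n _ <-]; exists n.
apply/le_anti/andP; split; last first.
  by apply: ge_sup => [|_ [n _ <-]//]; exists (h 0%N), 0%N.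
apply: fD_le_urat => // n; have : h n <= sup (range h).
  by apply: ub_le_sup => //; exists n.
by rewrite ge_max => /andP[].
Qed.

End urat.

(** * The L^p norm of nonnegative real functions *)

Section Np.
Context d (T : measurableType d) (R : realType) (mu : {measure set T -> \bar R}).
Variables (D : set T) (mD : measurable D) (p : R) (p1 : 1 <= p).
Implicit Types F G H : T -> R.

Definition Ip F : \bar R := (\int[mu]_(x in D) (F x `^ p)%:E)%E.
(** Since [fine] sends [+oo] to 0, this is the norm only when [Ip F] is finite. The integral is
    therefore tracked separately. *)
Definition Np F : R := fine (Ip F) `^ p^-1.

Let p0 : 0 < p. Proof. exact: lt_le_trans p1. Qed.
Let pN0 : p != 0. Proof. by rewrite gt_eqF. Qed.

Lemma Ip_ge0 F : (0 <= Ip F)%E.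
Proof. by apply: integral_ge0 => x _; rewrite lee_fin powR_ge0. Qed.

Lemma Np_ge0 F : 0 <= Np F.
Proof. exact: powR_ge0. Qed.

Lemma Ip_fin_num F : (Ip F < +oo)%E -> Ip F \is a fin_num.
Proof. by rewrite ge0_fin_numE// Ip_ge0. Qed.

Lemma poweR_Ip F : (Ip F < +oo)%E -> ((Ip F) `^ p^-1)%E = (Np F)%:E.
Proof. by move=> /Ip_fin_num/fineK {1}<-. Qed.

Lemma Ip_fin F : (Ip F < +oo)%E -> Ip F = (Np F `^ p)%:E.
Proof.
move=> /poweR_Ip; rewrite -poweR_EFin => <-; rewrite -poweRrM mulVf// poweRe1//.
exact: Ip_ge0.
Qed.

Lemma eq_Ip F G : {in D, F =1 G} -> Ip F = Ip G.
Proof. by move=> FG; apply: eq_integral => x /FG ->. Qed.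

Lemma eq_Np F G : {in D, F =1 G} -> Np F = Np G.
Proof. by move=> FG; rewrite /Np (eq_Ip FG). Qed.

Lemma measurable_EFin_powR F : measurable_fun D F ->
  measurable_fun D (fun x => (F x `^ p)%:E).
Proof.
by move=> mF; apply/measurable_EFinP; apply: (measurableT_comp (measurable_powR p)).
Qed.

Lemma le_Ip F G : measurable_fun D F -> measurable_fun D G ->
  (forall x, D x -> 0 <= F x <= G x) -> (Ip F <= Ip G)%E.
Proof.
move=> mF mG FG; apply: ge0_le_integral => //.
- by move=> x _; rewrite lee_fin powR_ge0.
- exact: measurable_EFin_powR.
- exact: measurable_EFin_powR.
- move=> x /FG /andP[F0 FGx]; rewrite lee_fin ge0_ler_powR ?nnegrE ?(ltW p0)//.
  exact: le_trans FGx.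
Qed.

Lemma ae_eq_Ip F G : measurable_fun D F -> measurable_fun D G ->
  {ae mu, forall x, D x -> F x = G x} -> Ip F = Ip G.
Proof.
move=> mF mG FG; apply: ge0_ae_eq_integral => //.
- exact: measurable_EFin_powR.
- exact: measurable_EFin_powR.
- by move=> x _; rewrite lee_fin powR_ge0.
- by move=> x _; rewrite lee_fin powR_ge0.
- by apply: filterS FG => x FG Dx; rewrite FG.
Qed.

(** [Lnorm] integrates over the whole space, so [F] is extended by 0 outside [D]. *)
Lemma Lnorm_Ip F : (forall x, D x -> 0 <= F x) ->
  Lnorm mu p%:E (EFin \o (F \_ D)) = ((Ip F) `^ p^-1)%E.
Proof.
move=> F0; rewrite unlock /Ip [in RHS]integral_mkcond; congr (_ `^ _)%E.
apply: eq_integral => x _; rewrite /= !patchE; case: ifPn => [xD|_].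
  by rewrite /= ger0_norm ?F0//; exact: set_mem.
by rewrite /= normr0 powR0.
Qed.

(** [H] is only dominated by [F + G], the form in which a triangle inequality holds pointwise.
    Minkowski in the extended reals also yields finiteness of the integral for [F + G], hence for
    [H]. *)
Lemma minkowski_Np F G H :
  measurable_fun D F -> measurable_fun D G -> measurable_fun D H ->
  (forall x, D x -> [/\ 0 <= F x, 0 <= G x & 0 <= H x <= F x + G x]) ->
  (Ip F < +oo)%E -> (Ip G < +oo)%E ->
  (Ip H < +oo)%E /\ Np H <= Np F + Np G.
Proof.
move=> mF mG mH FGH Fy Gy.
have mFG : measurable_fun D (F \+ G) by exact: measurable_funD.
have IH : (Ip H <= Ip (F \+ G)%R)%E by apply: le_Ip => // x /FGH[].
have M : ((Ip (F \+ G)%R) `^ p^-1 <= (Ip F) `^ p^-1 + (Ip G) `^ p^-1)%E.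
  rewrite -!Lnorm_Ip; [|by move=> x /FGH[]..|]; last first.
    by move=> x /FGH[? ? _] /=; exact: addr_ge0.
  rewrite (_ : (F \+ G)%R \_ D = ((F \_ D) \+ (G \_ D))%R); last first.
    by apply/funext => x /=; rewrite !patchE; case: ifP => // _; rewrite addr0.
  by apply: minkowski_EFin => //; exact/(measurable_restrictT _ mD).1.
have FGy : (Ip (F \+ G)%R < +oo)%E.
  rewrite (@lty_poweRy _ _ p^-1) ?invr_eq0//.
  by rewrite (le_lt_trans M)// lte_add_pinfty// poweR_lty.
have Hy := le_lt_trans IH FGy.
split; first exact: Hy.
rewrite (poweR_Ip Fy) (poweR_Ip Gy) in M.
rewrite -lee_fin EFinD; apply: le_trans M; rewrite -(poweR_Ip Hy).
apply: gt0_ler_poweR IH; first by rewrite invr_ge0 ltW.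
  by rewrite in_itv/= Ip_ge0 leey.
by rewrite in_itv/= Ip_ge0 leey.
Qed.

Lemma Np_eq0 F : measurable_fun D F -> (Ip F < +oo)%E ->
  Np F = 0 <-> {ae mu, forall x, D x -> F x = 0}.
Proof.
move=> mF Fy; have mFp := measurable_EFin_powR mF.
have E : Ip F = (\int[mu]_(x in D) `|(F x `^ p)%:E|)%E.
  by apply: eq_integral => x _; rewrite gee0_abs// lee_fin powR_ge0.
have NE : Np F = 0 <-> Ip F = 0%E.
  rewrite (Ip_fin Fy); split => [->|[] /powR_eq0_eq0//].
  by rewrite powR0.
rewrite NE E (ae_eq_integral_abs mu mD mFp); split; apply: filterS => x h Dx.
  by have [] := h Dx => /powR_eq0_eq0.
by rewrite h// powR0.
Qed.

Lemma Ip_scale c F : 0 <= c -> measurable_fun D F -> (forall x, D x -> 0 <= F x) ->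
  Ip (fun x => c * F x) = ((c `^ p)%:E * Ip F)%E.
Proof.
move=> c0 mF F0; rewrite /Ip -ge0_integralZl//.
- by apply: eq_integral => x /set_mem Dx; rewrite powRM ?F0.
- exact: measurable_EFin_powR.
- by move=> x _; rewrite lee_fin powR_ge0.
- by rewrite lee_fin powR_ge0.
Qed.

Lemma Np_scale c F : 0 <= c -> measurable_fun D F -> (forall x, D x -> 0 <= F x) ->
  (Ip F < +oo)%E -> Np (fun x => c * F x) = c * Np F.
Proof.
move=> c0 mF F0 Fy; rewrite {1}/Np Ip_scale// fineM ?Ip_fin_num//.
rewrite powRM ?powR_ge0 ?fine_ge0 ?Ip_ge0//=.
by rewrite -powRrM divff// powRr1.
Qed.

Lemma Np_le F e : (Ip F < +oo)%E -> 0 <= e -> (Ip F <= (e `^ p)%:E)%E = (Np F <= e).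
Proof.
move=> Fy e0; rewrite Ip_fin// lee_fin; apply/idP/idP => [h|h].
  rewrite leNgt; apply/negP => eN; move: h; rewrite leNgt.
  by rewrite gt0_ltr_powR ?nnegrE ?Np_ge0.
by rewrite ge0_ler_powR ?nnegrE ?Np_ge0// ltW.
Qed.

(* The series of the [(2^k F_k)^p] has a finite integral, so that it converges a.e.
   and in particular its terms are bounded. *)
Lemma ae_geometric (F : nat -> T -> R) :
  (forall k, measurable_fun D (F k)) -> (forall k x, D x -> 0 <= F k x) ->
  (forall k, (Ip (fun x => 2 ^+ k * F k x)%R <= (1 / (2 ^ k.+1)%:R)%R%:E)%E) ->
  exists A, [/\ measurable A, A `<=` D, mu (D `\` A) = 0 &
    forall x, A x -> exists C, forall k, F k x <= C / 2 ^+ k].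
Proof.
move=> mF F0 IF.
have m2F k : measurable_fun D (fun x => 2 ^+ k * F k x).
  by apply: measurable_funM => //; exact: measurable_cst.
pose h k x := ((2 ^+ k * F k x) `^ p)%:E.
have mh k : measurable_fun D (h k) by exact: measurable_EFin_powR.
have h0 k x : (0 <= h k x)%E by rewrite lee_fin powR_ge0.
pose S x := (\sum_(0 <= k <oo) h k x)%E.
have S0 x : (0 <= S x)%E by exact: nneseries_ge0.
have mS : measurable_fun D S.
  by apply: ge0_emeasurable_sum => // k x _ _; exact: h0.
have IS : (\int[mu]_(x in D) S x < +oo)%E.
  rewrite integral_nneseries//; apply: (@le_lt_trans _ _ 1%E); last exact: ltry.
  (* The bounds [1 / 2 ^ k.+1] have total at most 1. *)
  apply: le_trans (epsilon_trick0 xpredT (@ler01 R)).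
  by apply: lee_nneseries => // k _; [rewrite integral_ge0|exact: IF].
have iS : mu.-integrable D S.
  by apply/integrableP; split => //; under eq_integral do rewrite gee0_abs//.
pose A := D `&` [set x | (S x < +oo)%E].
have mA : measurable A.
  by apply: emeasurable_fun_infty_o.
exists A; split => //; first by move=> x [].
  apply: measure_negligible; first exact: measurableD.
  apply: negligibleS (integrable_ae mD iS) => x [Dx nA] /= Sfin.
  by apply: nA; split => //=; rewrite -ge0_fin_numE//; exact: Sfin.
(* Each nonnegative term is at most the sum [S x]. Taking p-th roots bounds [2 ^+ k * F k x]
   independently of [k]. *)
move=> x [Dx Sy]; exists (fine (S x) `^ p^-1) => k.
rewrite ler_pdivlMr ?exprn_gt0// mulrC.
have hS : (h k x <= S x)%E.
  apply: le_trans (nneseries_lim_ge k.+1 _); last by move=> *; exact: h0.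
  rewrite big_mkord big_ord_recr/= leeDr// sume_ge0// => i _; exact: h0.
have F2 : 0 <= 2 ^+ k * F k x by rewrite mulr_ge0 ?exprn_ge0 ?F0.
have -> : 2 ^+ k * F k x = ((2 ^+ k * F k x) `^ p) `^ p^-1.
  by rewrite -powRrM divff// powRr1.
apply: ge0_ler_powR.
- by rewrite invr_ge0 ltW.
- by rewrite nnegrE powR_ge0.
- by rewrite nnegrE fine_ge0.
- by rewrite -lee_fin fineK ?ge0_fin_numE//; exact: hS.
Qed.

Lemma cvg_powR_nneg (x : nat -> R) c : (forall n, 0 <= x n) ->
  x @ \oo --> c -> (fun n => x n `^ p) @ \oo --> c `^ p.
Proof.
move=> x0 xc; have c0 : 0 <= c.
  by rewrite -(cvg_lim (@Rhausdorff R) xc); apply: limr_ge;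
    [exact: cvgP xc|exact: nearW].
move: c0; rewrite le_eqVlt => /predU1P[c0|c0]; last first.
  apply: (@continuous_cvg _ R R _ _ _ (fun y : R => y `^ p)) => //.
  apply/differentiable_continuous/derivable1_diffP/derivable_powR.
  by rewrite in_itv/= c0.
rewrite -c0 powR0//; rewrite -c0 in xc; apply: (squeeze_cvgr _ (cvg_cst 0) xc).
have : \forall n \near \oo, x n < 1 by apply: (cvgr_lt 0 xc); exact: ltr01.
apply: filterS => n xn1; rewrite powR_ge0/=.
have := x0 n; rewrite le_eqVlt => /predU1P[<-|xn0]; first by rewrite powR0.
by rewrite ge1r_powR// xn0 ltW.
Qed.

Lemma fatou_Ip (F : nat -> T -> R) G c :
  (forall k, measurable_fun D (F k)) -> (forall k x, D x -> 0 <= F k x) ->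
  (forall x, D x -> F ^~ x @ \oo --> G x) ->
  (forall k, (Ip (F k) <= c)%E) -> (Ip G <= c)%E.
Proof.
move=> mF F0 FG Fc.
have -> : Ip G = (\int[mu]_(x in D) limn_einf (fun k => (F k x `^ p)%:E))%E.
  apply: eq_integral => x /set_mem Dx.
  suff /cvg_limn_einf_sup[-> _] :
      (fun k => (F k x `^ p)%:E) @ \oo --> (G x `^ p)%:E by [].
  apply: cvg_EFin; first exact: nearW.
  by apply: cvg_powR_nneg => //; [move=> k; exact: F0|exact: FG].
apply: le_trans (fatou mu mD _ _) _.
- by move=> k; exact: measurable_EFin_powR.
- by move=> k x _; rewrite lee_fin powR_ge0.
rewrite limn_einf_lim; apply: lime_le; first exact: is_cvg_einfs.
apply: nearW => k; apply: le_trans (Fc k).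
by apply: ereal_inf_lbound; exists k => /=.
Qed.

End Np.

(** * The L^p space of fuzzy-valued functions over a general measure *)

Section Lp.
Context d (T : measurableType d) (R : realType) (mu : {measure set T -> \bar R}).
Variables (D : set T) (mD : measurable D).
Implicit Types f g h e : T -> R -> R.

Definition fuzzy_on f := forall x, D x -> is_fuzzy (f x).

Definition smeasurable f := forall r, 0 <= r <= 1 ->
  measurable_fun D (fun x => lend (f x) r) /\
  measurable_fun D (fun x => rend (f x) r).

Lemma measurable_fD f g : fuzzy_on f -> fuzzy_on g ->
  smeasurable f -> smeasurable g -> measurable_fun D (fun x => fD (f x) (g x)).
Proof.
move=> ff fg mf mg.
pose h n x := Num.max `|lend (f x) (urat R n) - lend (g x) (urat R n)|
                      `|rend (f x) (urat R n) - rend (g x) (urat R n)|.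
apply: (@eq_measurable_fun _ _ _ _ _ (fun x => sups (h ^~ x) 0%N)).
  by move=> x /set_mem Dx; rewrite (fD_sups (ff x Dx) (fg x Dx)).2.
apply: measurable_fun_sups => [x Dx|n]; first exact: (fD_sups (ff x Dx) (fg x Dx)).1.
have [mlf mrf] := mf _ (urat01 R n); have [mlg mrg] := mg _ (urat01 R n).
by apply: measurable_maxr; apply: measurableT_comp => //; exact: measurable_funB.
Qed.

Lemma fuzzy_on_cst u : is_fuzzy u -> fuzzy_on (fun=> u).
Proof. by move=> fu x _. Qed.

Lemma smeasurable_cst u : smeasurable (fun=> u).
Proof. by move=> r _; split; exact: measurable_cst. Qed.

Lemma fuzzy_on_fadd f g : fuzzy_on f -> fuzzy_on g ->
  fuzzy_on (fun x => fadd (f x) (g x)).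
Proof. by move=> ff fg x Dx; exact: (fadd_ends (ff x Dx) (fg x Dx)).1. Qed.

Lemma smeasurable_fadd f g : fuzzy_on f -> fuzzy_on g ->
  smeasurable f -> smeasurable g -> smeasurable (fun x => fadd (f x) (g x)).
Proof.
move=> ff fg mf mg r r01; have [mlf mrf] := mf _ r01; have [mlg mrg] := mg _ r01.
split.
- apply: (@eq_measurable_fun _ _ _ _ _ (fun x => lend (f x) r + lend (g x) r)).
    by move=> x /set_mem Dx; rewrite ((fadd_ends (ff x Dx) (fg x Dx)).2 _ r01).1.
  exact: measurable_funD.
- apply: (@eq_measurable_fun _ _ _ _ _ (fun x => rend (f x) r + rend (g x) r)).
    by move=> x /set_mem Dx; rewrite ((fadd_ends (ff x Dx) (fg x Dx)).2 _ r01).2.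
  exact: measurable_funD.
Qed.

(** Convergence in [fD] dominates convergence of both endpoints at each level, so these are
    pointwise limits of measurable functions. *)
Lemma smeasurable_cvg (v : nat -> T -> R -> R) f :
  (forall n, fuzzy_on (v n)) -> fuzzy_on f -> (forall n, smeasurable (v n)) ->
  (forall x, D x -> (fun n => fD (v n x) (f x)) @ \oo --> 0) -> smeasurable f.
Proof.
move=> fv ff mv vf r r01; split.
- apply: (@measurable_fun_cvg _ _ _ _ (fun n x => lend (v n x) r)) => [n|x Dx].
    by have [] := mv n _ r01.
  apply/cvgrPdist_le => e e0; have /cvgrPdist_le /(_ _ e0) := vf x Dx.
  apply: filterS => n; rewrite sub0r normrN distrC; apply: le_trans.
  by rewrite (le_trans _ (ler_norm _))// fD_lend//; [exact: fv|exact: ff].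
- apply: (@measurable_fun_cvg _ _ _ _ (fun n x => rend (v n x) r)) => [n|x Dx].
    by have [] := mv n _ r01.
  apply/cvgrPdist_le => e e0; have /cvgrPdist_le /(_ _ e0) := vf x Dx.
  apply: filterS => n; rewrite sub0r normrN distrC; apply: le_trans.
  by rewrite (le_trans _ (ler_norm _))// fD_rend//; [exact: fv|exact: ff].
Qed.

Variables (p : R) (p1 : 1 <= p).

Definition inLp f :=
  [/\ fuzzy_on f, smeasurable f & (Ip mu D p (fun x => fD fzero (f x)) < +oo)%E].

Definition Dp f g := Np mu D p (fun x => fD (f x) (g x)).

Lemma inLp_measurable_fD f g : inLp f -> inLp g ->
  measurable_fun D (fun x => fD (f x) (g x)).
Proof. by move=> [ff mf _] [fg mg _]; exact: measurable_fD. Qed.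

(** Only finiteness of the two distances is assumed, so that the lemma can also prove that a
    function belongs to L^p, by taking [fzero] as [f]. *)
Lemma Ip_fD_triangle f g h : fuzzy_on f -> fuzzy_on g -> fuzzy_on h ->
  smeasurable f -> smeasurable g -> smeasurable h ->
  (Ip mu D p (fun x => fD (f x) (g x)) < +oo)%E ->
  (Ip mu D p (fun x => fD (g x) (h x)) < +oo)%E ->
  (Ip mu D p (fun x => fD (f x) (h x)) < +oo)%E /\ Dp f h <= Dp f g + Dp g h.
Proof.
move=> ff fg fh mf mg mh fgy ghy.
apply: minkowski_Np => //; try exact: measurable_fD.
move=> x Dx; have ffx := ff x Dx; have fgx := fg x Dx; have fhx := fh x Dx.
by rewrite !fD_ge0//; split => //; exact: fD_triangle.
Qed.

Lemma Ip_fDC f g :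
  Ip mu D p (fun x => fD (f x) (g x)) = Ip mu D p (fun x => fD (g x) (f x)).
Proof. by apply: eq_Ip => x _; exact: fDC. Qed.

Lemma inLp_Ip_fD f g : inLp f -> inLp g ->
  (Ip mu D p (fun x => fD (f x) (g x)) < +oo)%E.
Proof.
move=> [ff mf fy] [fg mg gy].
have fz := fuzzy_on_cst (@is_fuzzy_fzero R); have mz := smeasurable_cst fzero.
by apply: (Ip_fD_triangle ff fz fg mf mz mg _ gy).1; rewrite (Ip_fDC _ (fun=> fzero)).
Qed.

Lemma Dp_triangle f g h : inLp f -> inLp g -> inLp h ->
  Dp f h <= Dp f g + Dp g h.
Proof.
move=> Lf Lg Lh; have fgy := inLp_Ip_fD Lf Lg; have ghy := inLp_Ip_fD Lg Lh.
case: Lf Lg Lh => [ff mf _] [fg mg _] [fh mh _].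
exact: (Ip_fD_triangle ff fg fh mf mg mh fgy ghy).2.
Qed.

Lemma DpC f g : Dp f g = Dp g f.
Proof. by rewrite /Dp /Np Ip_fDC. Qed.

Lemma Dp_eq0 f g : inLp f -> inLp g ->
  Dp f g = 0 <-> {ae mu, forall x, D x -> f x = g x}.
Proof.
move=> Lf Lg; rewrite /Dp Np_eq0//; last 2 first.
- exact: inLp_measurable_fD.
- exact: inLp_Ip_fD.
case: Lf Lg => [ff _ _] [fg _ _].
split; apply: filterS => x fgx Dx; first exact: (fD_eq0 (ff x Dx) (fg x Dx) (fgx Dx)).
by rewrite fgx// fDxx//; exact: fg.
Qed.

Lemma Dp_faddr f g h : inLp f -> inLp g -> inLp h ->
  Dp (fun x => fadd (f x) (h x)) (fun x => fadd (g x) (h x)) = Dp f g.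
Proof.
move=> [ff _ _] [fg _ _] [fh _ _]; rewrite /Dp; apply: eq_Np.
by move=> x /set_mem Dx; rewrite fD_faddr; [|exact: ff|exact: fg|exact: fh].
Qed.

Lemma Dp_fscale l f g : inLp f -> inLp g ->
  Dp (fun x => fscale l (f x)) (fun x => fscale l (g x)) = `|l| * Dp f g.
Proof.
move=> Lf Lg; have mfg := inLp_measurable_fD Lf Lg; have fgy := inLp_Ip_fD Lf Lg.
case: Lf Lg => [ff _ _] [fg _ _].
have fg0 x : D x -> 0 <= fD (f x) (g x).
  by move=> Dx; apply: fD_ge0; [exact: ff|exact: fg].
apply: etrans (Np_scale mD p1 (normr_ge0 l) mfg fg0 fgy); apply: eq_Np.
by move=> x /set_mem Dx; rewrite fD_fscale; [|exact: ff|exact: fg].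
Qed.

Lemma Dp_fadd f g h e : inLp f -> inLp g -> inLp h -> inLp e ->
  Dp (fun x => fadd (f x) (g x)) (fun x => fadd (h x) (e x)) <= Dp f h + Dp g e.
Proof.
move=> Lf Lg Lh Le.
have [mfh mge] := (inLp_measurable_fD Lf Lh, inLp_measurable_fD Lg Le).
have [fhy gey] := (inLp_Ip_fD Lf Lh, inLp_Ip_fD Lg Le).
case: Lf Lg Lh Le => [ff mf _] [fg mg _] [fh mh _] [fe me _].
have ffg := fuzzy_on_fadd ff fg; have fhe := fuzzy_on_fadd fh fe.
have mfghe : measurable_fun D (fun x => fD (fadd (f x) (g x)) (fadd (h x) (e x))).
  by apply: measurable_fD => //; exact: smeasurable_fadd.
apply: (minkowski_Np mD p1 mfh mge mfghe _ fhy gey).2 => x Dx.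
have ffx := ff x Dx; have fgx := fg x Dx; have fhx := fh x Dx; have fex := fe x Dx.
have ffgx := ffg x Dx; have fhex := fhe x Dx.
by rewrite !fD_ge0//; split => //; exact: fD_fadd.
Qed.


(** The limit [f] is built from a subsequence, but the Cauchy bound is passed to the limit for every
    late [u m]. The resulting estimate gives both membership of [f] in L^p and convergence of the
    full sequence. *)
Lemma Lp_complete (u : nat -> T -> R -> R) : (forall n, inLp (u n)) ->
  (forall e : R, 0 < e -> exists N, forall m n,
     (N <= m)%N -> (N <= n)%N -> Dp (u m) (u n) < e) ->
  exists f, inLp f /\ (fun n => Dp (u n) f) @ \oo --> 0.
Proof.
move=> Lu cu.
have fu n : fuzzy_on (u n) by case: (Lu n).
have mu' n : smeasurable (u n) by case: (Lu n).
(* The factor [(2 ^+ k)^-1] compensates the weight [2 ^+ k] in [ae_geometric]; the other factor is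
   the summable bound required there. *)
have /choice[N HN] k : exists Nk, forall m n, (Nk <= m)%N -> (Nk <= n)%N ->
    Dp (u m) (u n) < (2 ^+ k)^-1 * (1 / (2 ^ k.+1)%:R).
  by apply: cu; rewrite mulr_gt0 ?invr_gt0 ?exprn_gt0// divr_gt0// ltr0n expn_gt0.
(* Summing the [(N i).+1] makes [s] increasing, with [s k] at least [N k] and at least [k]. Thus
   [s k] and [s k.+1] are both beyond [N k]. *)
pose s k := (\sum_(i < k.+1) (N i).+1)%N.
have sS k : s k.+1 = (s k + (N k.+1).+1)%N by rewrite /s big_ord_recr.
have Ns k : (N k <= s k)%N.
  by rewrite /s big_ord_recr/= (leq_trans (leqnSn _))// leq_addl.
have ks k : (k <= s k)%N.
  by elim: k => // k IH; rewrite sS addnS ltnS (leq_trans IH)// leq_addr.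
pose F k x := fD (u (s k) x) (u (s k.+1) x).
have mF k : measurable_fun D (F k) by exact: inLp_measurable_fD.
have F0 k x : D x -> 0 <= F k x.
  by move=> Dx; apply: fD_ge0; exact: fu.
have Fy k : (Ip mu D p (F k) < +oo)%E by exact: inLp_Ip_fD.
have IF k : (Ip mu D p (fun x => 2 ^+ k * F k x)%R <= (1 / (2 ^ k.+1)%:R)%R%:E)%E.
  have k0 : 0 <= 2 ^+ k :> R by exact: exprn_ge0.
  have d0 : 0 < 1 / (2 ^ k.+1)%:R :> R by rewrite divr_gt0// ltr0n expn_gt0.
  have d1 : 1 / (2 ^ k.+1)%:R <= 1 :> R.
    by rewrite ler_pdivrMr ?ltr0n ?expn_gt0// mul1r ler1n expn_gt0.
  (* The bound is at most 1 and [1 <= p], so its p-th power is smaller. It suffices to bound the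
     integral by that power, which is a bound on [Np]. *)
  apply: (@le_trans _ _ ((1 / (2 ^ k.+1)%:R) `^ p)%:E); last first.
    by rewrite lee_fin ge1r_powR// d0.
  have Iy : (Ip mu D p (fun x => 2 ^+ k * F k x)%R < +oo)%E.
    rewrite (Ip_scale mu mD p k0 (mF k) (F0 k)).
    by apply: lte_mul_pinfty => //; rewrite lee_fin powR_ge0.
  rewrite (Np_le p1 Iy (ltW d0)) (Np_scale mD p1 k0 (mF k) (F0 k) (Fy k)).
  rewrite -ler_pdivlMl ?exprn_gt0//; apply/ltW/HN; first exact: Ns.
  by rewrite (leq_trans (Ns k))// sS leq_addr.
have [A [mA AD muA FA]] := ae_geometric mD p1 mF F0 IF.
(* Replacing the subsequence by [fzero] off [A] gives convergence at every point of [D], at the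
   price of a change on a null set. *)
pose v k x := if x \in A then u (s k) x else fzero.
have fv k : fuzzy_on (v k).
  by move=> x Dx; rewrite /v; case: ifP => _; [exact: fu|exact: is_fuzzy_fzero].
have mv k : smeasurable (v k).
  move=> r r01; have [ml mr] := mu' (s k) r r01.
  have mDA (g : T -> R) : measurable_fun D g -> measurable_fun D (g \_ A).
    move=> mg; apply/(measurable_restrict g mA mD).
    by apply: measurable_funS mg => // x [].
  split.
  (* The endpoints of [fzero] are 0, so those of [v k] are the extensions by 0 of the endpoints of
     [u (s k)] from [A]. *)
  - rewrite (_ : (fun x => _) = (fun x => lend (u (s k) x) r) \_ A); first exact: mDA.
    by apply/funext => x; rewrite patchE /v; case: ifP; rewrite ?lend_fzero.
  - rewrite (_ : (fun x => _) = (fun x => rend (u (s k) x) r) \_ A); first exact: mDA.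
    by apply/funext => x; rewrite patchE /v; case: ifP; rewrite ?rend_fzero.
have /choice[f Hf] x : exists l, D x ->
    is_fuzzy l /\ (fun n => fD (v n x) l) @ \oo --> 0.
  have [Dx|nDx] := pselect (D x); last by exists fzero.
  have [C HC] : exists C, forall k, fD (v k x) (v k.+1 x) <= C / 2 ^+ k.
    rewrite /v; have [/set_mem/FA//|xA] := boolP (x \in A).
    by exists 0 => k; rewrite mul0r fDxx//; exact: is_fuzzy_fzero.
  have [l fl vl] := fD_geometric_cvg (fun k => fv k x Dx) HC.
  by exists l.
have ff : fuzzy_on f by move=> x /Hf[].
have mf : smeasurable f.
  by apply: (smeasurable_cvg fv ff mv) => x /Hf[].
have bound (e : R) : 0 < e -> exists M, forall m, (M <= m)%N ->
    (Ip mu D p (fun x => fD (u m x) (f x)) <= (e `^ p)%:E)%E.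
  move=> e0; have [M HM] := cu e e0; exists M => m Mm.
  (* [fatou_Ip] needs its bound for all indices. The shift by [M] ensures [M <= s (j + M)], so that
     the Cauchy estimate applies to every [j]. *)
  apply: (fatou_Ip mD p1 (F := fun j x => fD (u m x) (v (j + M)%N x))).
  - by move=> j; exact: measurable_fD.
  - by move=> j x Dx; apply: fD_ge0; [exact: fu|exact: fv].
  - move=> x Dx; have [fx vfx] := Hf x Dx.
    have := vfx; rewrite -(cvg_shiftn M) => /cvgrPdist_le h.
    apply/cvgrPdist_le => e' e'0; have := h e' e'0; apply: filterS => j /=.
    rewrite sub0r normrN; apply: le_trans; rewrite (le_trans _ (ler_norm _))//.
    by rewrite distrC; apply: fD_dist => //; [exact: fu|exact: fv].
  - move=> j; have -> : Ip mu D p (fun x => fD (u m x) (v (j + M)%N x)) =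
        Ip mu D p (fun x => fD (u m x) (u (s (j + M)%N) x)).
      apply: ae_eq_Ip => //; [exact: measurable_fD|exact: measurable_fD|].
      (* Within [D], [v] and the subsequence can differ only on the null set [D] minus [A]. *)
      exists (D `\` A); split => //; first exact: measurableD.
      move=> x /= h; apply: contrapT => nDA; apply: h => Dx; rewrite /v.
      by case: ifPn => // /negP xA; exfalso; apply: nDA; split => // /mem_set.
    rewrite (Np_le p1 (inLp_Ip_fD (Lu _) (Lu _)) (ltW e0)).
    by apply/ltW/HM => //; rewrite (leq_trans _ (ks _))// leq_addl.
have bound_lty m c : (Ip mu D p (fun x => fD (u m x) (f x)) <= c%:E)%E ->
    (Ip mu D p (fun x => fD (u m x) (f x)) < +oo)%E.
  by move=> /le_lt_trans; apply; exact: ltry.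
exists f; split.
  split => //; have [M HM] := bound 1 ltr01.
  have fz := fuzzy_on_cst (@is_fuzzy_fzero R); have mz := smeasurable_cst (@fzero R).
  have uy : (Ip mu D p (fun x => fD fzero (u M x)) < +oo)%E by case: (Lu M).
  apply: (Ip_fD_triangle fz (fu M) ff mz (mu' M) mf uy _).1.
  exact: bound_lty (HM M (leqnn M)).
apply/cvgrPdist_le => e e0; have [M HM] := bound e e0.
exists M => // m /= /HM h; rewrite sub0r normrN ger0_norm; last exact: Np_ge0.
by rewrite -(Np_le p1 (bound_lty _ _ h) (ltW e0)).
Qed.

End Lp.

(** * Specialisation to completed Lebesgue measure on an interval *)

Theorem theorem2p6 (R : realType) (a b : R) :
  (* (i) *)
  (forall f : R -> R -> R,
     fuzzy_valued a b f -> strongly_measurable a b f ->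
     leb_measurable_fun `[a, b] (fun x => fD fzero (f x))) /\
  (* (ii) *)
  (forall p : R, 1 <= p ->
    (forall f g, LpF p a b f -> LpF p a b g ->
       leb_measurable_fun `[a, b] (fun x => fD (f x) (g x)) /\
       (intF_ab a b (fun x => powR (fD (f x) (g x)) p) < +oo)%E) /\
    (* D_p is a metric on L^p modulo a.e. equality *)
    (forall f g, LpF p a b f -> LpF p a b g -> 0 <= DpF p a b f g) /\
    (forall f g, LpF p a b f -> LpF p a b g ->
       (DpF p a b f g = 0 <-> fae_eq a b f g)) /\
    (forall f g, LpF p a b f -> LpF p a b g -> DpF p a b f g = DpF p a b g f) /\
    (forall f g h, LpF p a b f -> LpF p a b g -> LpF p a b h ->
       DpF p a b f h <= DpF p a b f g + DpF p a b g h) /\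
    (* completeness *)
    (forall u : nat -> R -> R -> R, (forall n, LpF p a b (u n)) ->
       (forall e : R, 0 < e -> exists N : nat, forall m n : nat,
           (N <= m)%N -> (N <= n)%N -> DpF p a b (u m) (u n) < e) ->
       exists f, LpF p a b f /\ (fun n => DpF p a b (u n) f) @ \oo --> (0 : R)) /\
    (* compatibility with the operations *)
    (forall f g h, LpF p a b f -> LpF p a b g -> LpF p a b h ->
       DpF p a b (Fadd f h) (Fadd g h) = DpF p a b f g) /\
    (forall f g (l : R), LpF p a b f -> LpF p a b g ->
       DpF p a b (Fscale l f) (Fscale l g) = `|l| * DpF p a b f g) /\
    (forall f g h e, LpF p a b f -> LpF p a b g -> LpF p a b h -> LpF p a b e ->
       DpF p a b (Fadd f g) (Fadd h e) <= DpF p a b f h + DpF p a b g e)).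
Proof.
(* The interval is Borel, and Borel sets belong to the completed sigma-algebra. *)
have mD : @measurable _ (LebT R) (`[a, b]%classic : set (LebT R)).
  exact: sub_caratheodory.
have inLpE p f : LpF p a b f <->
    inLp (@completed_lebesgue_measure R) (`[a, b]%classic : set (LebT R)) p f.
  by split=> -[ff mf fy]; split => // x; move: (ff x); rewrite /= in_itv.
split => [f ff mf|p p1].
  have ff' : fuzzy_on (`[a, b]%classic : set (LebT R)) f.
    by move=> x /=; rewrite in_itv/=; exact: ff.
  have fz := fuzzy_on_cst (D := `[a, b]%classic : set (LebT R)) (@is_fuzzy_fzero R).
  exact: (measurable_fD fz ff' (smeasurable_cst _ fzero) mf).
split=> [f g /inLpE Lf /inLpE Lg|].
  split; first exact: (inLp_measurable_fD Lf Lg).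
  exact: (inLp_Ip_fD mD p1 Lf Lg).
split=> [f g _ _|]; first exact: Np_ge0.
split=> [f g /inLpE Lf /inLpE Lg|]; first exact: (Dp_eq0 mD p1 Lf Lg).
split=> [f g _ _|]; first exact: DpC.
split=> [f g h /inLpE Lf /inLpE Lg /inLpE Lh|]; first exact: (Dp_triangle mD p1 Lf Lg Lh).
split=> [u Lu cu|].
  have [|f [Lf uf]] := Lp_complete mD p1 _ cu; first by move=> n; exact/inLpE/Lu.
  by exists f; split => //; exact/inLpE.
split=> [f g h /inLpE Lf /inLpE Lg /inLpE Lh|]; first exact: (Dp_faddr Lf Lg Lh).
split=> [f g l /inLpE Lf /inLpE Lg|]; first exact: (Dp_fscale mD p1 l Lf Lg).
by move=> f g h e /inLpE Lf /inLpE Lg /inLpE Lh /inLpE Le;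
  exact: (Dp_fadd mD p1 Lf Lg Lh Le).
Qed.
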